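(* For any finite group $G$ we have the following: (1) $M_1(\mathcal{B}(G))=|G|^2+\sum_{H\in L(G)}|H|^4(\varphi_2(H))^2$ and $M_2(\mathcal{B}(G))=\sum_{H\in L(G)}|H|^4(\varphi_2(H))^2$. (2) $R(\mathcal{B}(G))=\sum_{H\in L(G)}|H|(\varphi_2(H))^{\frac12}$. (3) $\mathrm{ABC}(\mathcal{B}(G))=\sum_{H\in L(G)}|H|\left(\left(|H|\varphi_2(H)\right)^2-\varphi_2(H)\right)^{\frac12}$. (4) $\mathrm{GA}(\mathcal{B}(G))=\sum_{H\in L(G)}\dfrac{2|H|^3(\varphi_2(H))^{\frac32}}{1+|H|^2\varphi_2(H)}$. (5) The Harmonic index of $\mathcal{B}(G)$ is $H(\mathcal{B}(G))=\sum_{H\in L(G)}\dfrac{2|H|^2\varphi_2(H)}{1+|H|^2\varphi_2(H)}$. (6) $\mathrm{SCI}(\mathcal{B}(G))=\sum_{H\in L(G)}|H|^2\varphi_2(H)\left(1+|H|^2\varphi_2(H)\right)^{-\frac12}$.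
   Context: For a group $G$, let $L(G)$ be the set of all subgroups of $G$. The graph $\mathcal{B}(G)$ is the simple undirected bipartite graph with vertex set the disjoint union $V(\mathcal{B}(G)) = (G\times G) \sqcup L(G)$, in which $(a,b)\in G\times G$ and $H \in L(G)$ are adjacent if and only if $H = \langle a,b\rangle$, and there are no other edges. For a finite group $H$, $\varphi_2(H)=\dfrac{|\{(a,b)\in H\times H:\langle a,b\rangle=H\}|}{|H|^2}$. For a finite graph $\Gamma$ with vertex set $V(\Gamma)$ and edge set $e(\Gamma)$, and with $\deg$ the vertex degree: first and second Zagreb indices: $M_1(\Gamma)=\sum_{v\in V(\Gamma)}\deg(v)^2$ and $M_2(\Gamma)=\sum_{uv\in e(\Gamma)}\deg(u)\deg(v)$; Randic Connectivity index: $R(\Gamma)=\sum_{uv\in e(\Gamma)}(\deg(u)\deg(v))^{-\frac12}$; Atom-Bond Connectivity index: $\mathrm{ABC}(\Gamma)=\sum_{uv\in e(\Gamma)}\left(\frac{\deg(u)+\deg(v)-2}{\deg(u)\deg(v)}\right)^{\frac12}$; Geometric-Arithmetic index: $\mathrm{GA}(\Gamma)=\sum_{uv\in e(\Gamma)}\frac{\sqrt{\deg(u)\deg(v)}}{\frac12(\deg(u)+\deg(v))}$; Harmonic index: $H(\Gamma)=\sum_{uv\in e(\Gamma)}\frac{2}{\deg(u)+\deg(v)}$; Sum-Connectivity index: $\mathrm{SCI}(\Gamma)=\sum_{uv\in e(\Gamma)}(\deg(u)+\deg(v))^{-\frac12}$. *)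

(* Defs.v *)
From mathcomp Require Import all_boot all_order all_algebra all_fingroup.
From mathcomp Require Import reals exp.

Set Implicit Arguments.
Unset Strict Implicit.
Unset Printing Implicit Defensive.

Import GroupScope GRing.Theory.
Local Open Scope ring_scope.

Record sgraph := SGraph {
  vertex : finType;
  adj : rel vertex;
  adj_sym : symmetric adj;
  adj_irr : irreflexive adj }.

Arguments adj {s} u v.

(* An edge uv is the two-element set {u, v}; hence, for an edge e, the degree
   sum deg u + deg v is \sum_(v in e) deg v, and likewise for the product. *)
Definition edges (X : sgraph) : {set {set vertex X}} :=
  [set e | [exists u, exists v, adj u v && (e == [set u; v])]].

Definition deg (X : sgraph) (v : vertex X) : nat := #|[set u | adj v u]|.

Section Indices.
Variables (R : realType) (X : sgraph).

Definition edge_degsum (e : {set vertex X}) : R := \sum_(v in e) (deg v)%:R.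
Definition edge_degprod (e : {set vertex X}) : R := \prod_(v in e) (deg v)%:R.

Definition zagreb1 : R := \sum_(v : vertex X) (deg v)%:R ^+ 2.

Definition zagreb2 : R := \sum_(e in edges X) edge_degprod e.

Definition randic : R :=
  \sum_(e in edges X) edge_degprod e `^ (- (1 / 2)).

Definition abc_index : R :=
  \sum_(e in edges X) ((edge_degsum e - 2) / edge_degprod e) `^ (1 / 2).

Definition ga_index : R :=
  \sum_(e in edges X) Num.sqrt (edge_degprod e) / (1 / 2 * edge_degsum e).

Definition harmonic : R := \sum_(e in edges X) 2 / edge_degsum e.

Definition sci : R := \sum_(e in edges X) edge_degsum e `^ (- (1 / 2)).

End Indices.

Section GeneratingGraph.
Variables (gT : finGroupType) (G : {group gT}).

Definition B_vertex : finType :=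
  ([subg G] * [subg G] + {H : {group gT} | H \in subgroups G})%type.

Definition B_adj : rel B_vertex := fun x y =>
  match x, y with
  | inl (a, b), inr H | inr H, inl (a, b) =>
      val H == <<[set sgval a; sgval b]>>%g :> {set gT}
  | _, _ => false
  end.

Lemma B_adj_sym : symmetric B_adj.
Proof. by move=> [[a b]|H] [[c d]|K]. Qed.

Lemma B_adj_irr : irreflexive B_adj.
Proof. by move=> [[a b]|H]. Qed.

Definition B_graph : sgraph := SGraph B_adj_sym B_adj_irr.

End GeneratingGraph.

Definition phi2 (R : realType) (gT : finGroupType) (H : {group gT}) : R :=
  #|[set p in setX H H | <<[set p.1; p.2]>>%g == H :> {set gT}]|%:R
  / #|H|%:R ^+ 2.

(* Main.v *)
(* Each pair (a, b) has a single neighbour, the subgroup <a, b>, so edges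
   correspond to pairs, and the edge at (a, b) has endpoint degrees 1 and n_H,
   where H = <a, b> and n_H = |H|^2 phi2(H) is the number of pairs generating
   H. Grouping the edges by H turns the sum over edges of f(deg u, deg v) into
   the sum over H of n_H f(1, n_H). Subgroups with n_H = 0 contribute 0. *)
Require Import Defs.
From mathcomp Require Import all_boot all_order all_algebra all_fingroup.
From mathcomp Require Import reals exp ring lra.

Set Implicit Arguments.
Unset Strict Implicit.
Unset Printing Implicit Defensive.

Import GroupScope GRing.Theory.
Import Order.TTheory Num.Theory.
Local Open Scope ring_scope.

Definition gen_pairs (gT : finGroupType) (H : {group gT}) : {set gT * gT} :=
  [set p in setX H H | <<[set p.1; p.2]>>%g == H :> {set gT}].

(** Translates between the two languages of the proof: degrees come out as the natural number
    [#|gen_pairs H|], whereas the claimed formulas are written with [phi2]. *)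
Lemma phi2_gen_pairs (R : realType) (gT : finGroupType) (H : {group gT}) :
  #|H|%:R ^+ 2 * phi2 R H = #|gen_pairs H|%:R.
Proof.
rewrite /phi2 mulrCA divff ?mulr1 //.
by rewrite expf_neq0 // pnatr_eq0 -lt0n cardG_gt0.
Qed.

Section GeneratingGraphEdges.
Variables (gT : finGroupType) (G : {group gT}).

Local Notation pairG := ([subg G] * [subg G])%type.

Definition gen_pair (p : pairG) : {group gT} :=
  <<[set sgval p.1; sgval p.2]>>%G.

Lemma gen_pair_subgroups p : gen_pair p \in subgroups G.
Proof.
by rewrite inE gen_subG; apply/subsetP=> x /set2P[]->; apply: subgP.
Qed.

Definition gen_vertex (p : pairG) : {H : {group gT} | H \in subgroups G} :=
  exist _ (gen_pair p) (gen_pair_subgroups p).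

Definition gen_edge (p : pairG) : {set vertex (B_graph G)} :=
  [set inl p; inr (gen_vertex p)].

Lemma gen_pair_eq p (H : {group gT}) :
  (gen_pair p == H) = (H == <<[set sgval p.1; sgval p.2]>>%g :> {set gT}).
Proof. by rewrite -val_eqE eq_sym. Qed.

Lemma B_adj_gen p (H : {H : {group gT} | H \in subgroups G}) :
  @adj (B_graph G) (inl p) (inr H) = (H == gen_vertex p).
Proof. by case: p => a b; rewrite -(inj_eq val_inj) [RHS]eq_sym gen_pair_eq. Qed.

(** The two counts live in different types, so they are compared through the injection that forgets
    membership in [G]. Generators of [H] lie in [H], and [H] is contained in [G], so the image of
    the left-hand set is exactly [gen_pairs H]. *)
Lemma card_gen_pair (H : {group gT}) : H \in subgroups G ->
  #|[set p | gen_pair p == H]| = #|gen_pairs H|.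
Proof.
rewrite inE => sHG.
pose f (p : pairG) := (sgval p.1, sgval p.2).
have injf : injective f.
  by move=> [a b] [c d] [/val_inj-> /val_inj->].
rewrite -(card_imset _ injf); apply: eq_card => -[x y].
rewrite !inE /=; apply/imsetP/andP => [[p] | [/andP[Hx Hy] /eqP eH]].
  rewrite inE gen_pair_eq => /eqP eH [-> ->]; rewrite eH eqxx.
  by rewrite !mem_gen ?set21 ?set22.
exists (subg G x, subg G y); last by rewrite /f /= !subgK ?(subsetP sHG).
by rewrite inE gen_pair_eq /= !subgK ?(subsetP sHG) // eH.
Qed.

Lemma deg_pair (p : pairG) : @deg (B_graph G) (inl p) = 1%N.
Proof.
rewrite /deg -(cards1 (inr (gen_vertex p) : vertex (B_graph G))).
apply: eq_card => -[q | H]; rewrite !inE.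
  by case: p.
by rewrite B_adj_gen.
Qed.

Lemma deg_subgroup (H : {H : {group gT} | H \in subgroups G}) :
  @deg (B_graph G) (inr H) = #|gen_pairs (val H)|.
Proof.
rewrite /deg -(card_gen_pair (valP H)).
have inlI : injective (inl : pairG -> vertex (B_graph G)) by move=> p q [].
rewrite -(card_imset _ inlI); apply: eq_card => -[p | K]; rewrite inE.
  rewrite adj_sym B_adj_gen (mem_imset _ _ inlI) inE.
  by rewrite -(inj_eq val_inj) eq_sym.
by apply/esym/negbTE/imsetP => -[].
Qed.

(** Such an edge has a single vertex on the pair side, and that vertex determines [p]. *)
Lemma gen_edge_inj : injective gen_edge.
Proof.
move=> p q /setP/(_ (inl p)); rewrite !inE eqxx /= orbF.
by move/esym/eqP => [].
Qed.

Lemma edges_B_graph : edges (B_graph G) = [set gen_edge p | p in setT].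
Proof.
apply/setP=> e; rewrite inE; apply/existsP/imsetP.
  case=> [[p|H]] /existsP[[q|K]].
  - by case: p => ? ?; rewrite andFb.
  - by case/andP; rewrite B_adj_gen => /eqP-> /eqP->; exists p; rewrite ?inE.
  - rewrite adj_sym B_adj_gen => /andP[/eqP-> /eqP->].
    by exists q; rewrite ?inE // setUC.
  - by rewrite andFb.
case=> p _ ->; exists (inl p); apply/existsP; exists (inr (gen_vertex p)).
by rewrite B_adj_gen !eqxx.
Qed.

(** Every edge-based index depends on the endpoint degrees only through their product and sum, so
    one function [F] of these two quantities serves all of them. *)
Lemma sum_edges_B_graph (R : realType) (F : R -> R -> R) :
  \sum_(e in edges (B_graph G)) F (edge_degprod R e) (edge_degsum R e)
  = \sum_(H in subgroups G)
      #|gen_pairs H|%:R * F #|gen_pairs H|%:R (1 + #|gen_pairs H|%:R).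
Proof.
rewrite edges_B_graph big_imset; last by move=> p q _ _; apply: gen_edge_inj.
rewrite (partition_big gen_pair (mem (subgroups G))) /=; last first.
  by move=> p _; apply: gen_pair_subgroups.
apply: eq_bigr => H sHG.
(* The summand is constant on the fibre of [gen_pair] over [H], so the leading factor is unfolded
   into a sum over that fibre. *)
rewrite -{1}(card_gen_pair sHG) mulr_natl -sumr_const.
apply: eq_big => [p | p /andP[_ /eqP <-]]; first by rewrite !inE.
by rewrite /edge_degprod /edge_degsum !big_setU1 ?inE //= !big_set1
  deg_pair deg_subgroup mul1r.
Qed.

(** This index sums over vertices, so the edge formula does not apply; the pairs, all of degree 1,
    account for the term [#|G|%:R ^+ 2]. *)
Lemma zagreb1_B_graph (R : realType) :
  zagreb1 R (B_graph G)
  = #|G|%:R ^+ 2 + \sum_(H in subgroups G) #|gen_pairs H|%:R ^+ 2.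
Proof.
rewrite /zagreb1 big_sumType [in RHS]big_sub; congr (_ + _).
  under eq_bigr do rewrite deg_pair expr1n.
  by rewrite sumr_const card_prod card_sub natrM -expr2.
by apply: eq_bigr => H _; rewrite deg_subgroup.
Qed.

End GeneratingGraphEdges.

Section PowerHalf.
Variable R : realType.
Implicit Types x y : R.

Lemma powR_half x : 0 <= x -> x `^ (1 / 2) = Num.sqrt x.
Proof. by move=> x0; rewrite div1r powR12_sqrt. Qed.

Lemma powR_three_halves x : 0 <= x -> x `^ (3 / 2) = x * Num.sqrt x.
Proof.
move=> x0; have [->|xn0] := eqVneq x 0.
  by rewrite powR0 ?mul0r //; lra.
rewrite (_ : 3 / 2 = 1 + 1 / 2); last by lra.
by rewrite powRD ?xn0 ?implybT // powRr1 // powR_half.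
Qed.

Lemma mul_powR_minus_half x : 0 <= x -> x * x `^ (- (1 / 2)) = Num.sqrt x.
Proof.
(* At [x = 0] the factor [x] annihilates the power; this covers the subgroups that no pair
   generates. *)
move=> x0; have [->|xn0] := eqVneq x 0; first by rewrite mul0r sqrtr0.
rewrite powRN powR_half // -{1}(sqr_sqrtr x0) expr2 mulfK //.
by rewrite sqrtr_eq0 -ltNge lt_neqAle eq_sym xn0.
Qed.

Lemma mul_sqrt x y : 0 <= x -> x * Num.sqrt y = Num.sqrt (x ^+ 2 * y).
Proof. by move=> x0; rewrite sqrtrM ?sqr_ge0 // sqrtr_sqr ger0_norm. Qed.

End PowerHalf.

Theorem theorem3p8 (R : realType) (gT : finGroupType) (G : {group gT}) :
  (zagreb1 R (B_graph G) =
     #|G|%:R ^+ 2 + \sum_(H in subgroups G) #|H|%:R ^+ 4 * phi2 R H ^+ 2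
   /\ zagreb2 R (B_graph G) =
     \sum_(H in subgroups G) #|H|%:R ^+ 4 * phi2 R H ^+ 2)
  /\ randic R (B_graph G) =
     \sum_(H in subgroups G) #|H|%:R * phi2 R H `^ (1 / 2)
  /\ abc_index R (B_graph G) =
     \sum_(H in subgroups G)
       #|H|%:R * ((#|H|%:R * phi2 R H) ^+ 2 - phi2 R H) `^ (1 / 2)
  /\ ga_index R (B_graph G) =
     \sum_(H in subgroups G)
       2 * #|H|%:R ^+ 3 * phi2 R H `^ (3 / 2) / (1 + #|H|%:R ^+ 2 * phi2 R H)
  /\ harmonic R (B_graph G) =
     \sum_(H in subgroups G)
       2 * #|H|%:R ^+ 2 * phi2 R H / (1 + #|H|%:R ^+ 2 * phi2 R H)
  /\ sci R (B_graph G) =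
     \sum_(H in subgroups G)
       #|H|%:R ^+ 2 * phi2 R H * (1 + #|H|%:R ^+ 2 * phi2 R H) `^ (- (1 / 2)).
Proof.
have h0 (H : {group gT}) : 0 < #|H|%:R :> R by rewrite ltr0n cardG_gt0.
have p0 (H : {group gT}) : 0 <= phi2 R H.
  by rewrite /phi2 divr_ge0 ?exprn_ge0 ?ler0n.
have nE (H : {group gT}) := phi2_gen_pairs R H.
split; [split|split; [|split; [|split; [|split]]]].
- rewrite zagreb1_B_graph; congr (_ + _); apply: eq_bigr => H _.
  by rewrite -nE; ring.
- rewrite /zagreb2 (sum_edges_B_graph _ (fun x _ => x)); apply: eq_bigr => H _.
  by rewrite -nE; ring.
- rewrite /randic (sum_edges_B_graph _ (fun x _ => x `^ (- (1 / 2)))).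
  apply: eq_bigr => H _; rewrite mul_powR_minus_half // -nE.
  by rewrite -mul_sqrt ?(ltW (h0 H)) // powR_half.
- rewrite /abc_index.
  rewrite (sum_edges_B_graph _ (fun x y => ((y - 2) / x) `^ (1 / 2))).
  (* The numerator of the radicand is [#|gen_pairs H|] minus 1, negative when no pair generates [H].
     In that case [phi2 R H] is 0 and both sides vanish; otherwise the count is [n.+1]. *)
  apply: eq_bigr => H _; have := nE H; case: #|gen_pairs H| => [|n] en.
    move/eqP: en; rewrite mulf_eq0 expf_eq0 (gt_eqF (h0 H)) /= => /eqP->.
    by rewrite mul0r mulr0 expr0n subr0 powR_half // sqrtr0 mulr0.
  have n0 : 0 <= n%:R :> R by [].
  have eh : (#|H|%:R * phi2 R H) ^+ 2 - phi2 R H = phi2 R H * n%:R.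
    have -> : n%:R = #|H|%:R ^+ 2 * phi2 R H - 1 :> R.
      by rewrite en -natr1 addrK.
    ring.
  have -> : 1 + n.+1%:R - 2 = n%:R :> R by rewrite -natr1; lra.
  rewrite eh powR_half ?divr_ge0 // powR_half; last exact: mulr_ge0.
  (* Once the outer factors are moved under the roots, both radicands equal [n.+1 * n]. *)
  rewrite !mul_sqrt ?(ltW (h0 H)) //; congr Num.sqrt.
  by rewrite [RHS]mulrA en; field; rewrite nat1r pnatr_eq0.
- rewrite /ga_index.
  rewrite (sum_edges_B_graph _ (fun x y => Num.sqrt x / (1 / 2 * y))).
  apply: eq_bigr => H _; have n0 : 0 <= #|gen_pairs H|%:R :> R by [].
  (* Taking [#|H|] out of the root leaves the root of [phi2 R H], which completes the power 3/2;
     [n0] keeps the denominator positive. *)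
  rewrite -nE in n0 *; rewrite -mul_sqrt ?(ltW (h0 H)) //.
  rewrite powR_three_halves //; field; rewrite gt_eqF //; lra.
- rewrite /harmonic (sum_edges_B_graph _ (fun _ y => 2 / y)).
  by apply: eq_bigr => H _; rewrite -nE; ring.
- rewrite /sci (sum_edges_B_graph _ (fun _ y => y `^ (- (1 / 2)))).
  by apply: eq_bigr => H _; rewrite -nE.
Qed.
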